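(* For all positive integers $k>r$, $$s(k,r)\le t(k,r).$$
   Context: Let $r<k$ be positive integers and $X$ a set. A sequence $x\in X^r$ covers a sequence $a\in X^k$ if $x$ is a (not necessarily contiguous) subsequence of $a$, i.e., $x$ is obtained from $a$ by removing $k-r$ entries while keeping the order of the remaining entries. A set $C\subseteq X^r$ covering $X^k$ (i.e., such that every sequence in $X^k$ is covered by at least one sequence in $C$) is called a covering $(k-r)$-insertion code over $X$. Write $[n]=\{0,1,\ldots,n-1\}$. $S(n,k,r)$ denotes the minimum cardinality of a covering $(k-r)$-insertion code $C\subseteq[n]^r$ over $[n]$, and $s(k,r)=\lim_{n\to\infty}S(n,k,r)/n^r$ (this limit exists). For $1\le r<k<n$, a family $C$ of $r$-element subsets of $[n]$ is a Turán $(n,k,r)$-system if every $k$-element subset of $[n]$ contains at least one member of $C$. $T(n,k,r)$ denotes the minimum cardinality of a Turán $(n,k,r)$-system, and $t(k,r)=\lim_{n\to\infty}T(n,k,r)/\binom nr$ is the Turán density (the limit exists because the sequence is non-decreasing in $n$). *)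

(* Defs.v *)
From HB Require Import structures.
From mathcomp Require Import all_boot all_order all_algebra.
From mathcomp Require Import all_classical all_reals all_analysis.
Set Implicit Arguments.
Unset Strict Implicit.
Unset Printing Implicit Defensive.
Import Order.TTheory GRing.Theory Num.Theory.
Import numFieldNormedType.Exports.

Definition covering_code (X : finType) (k r : nat) (C : {set r.-tuple X}) : bool :=
  [forall a : k.-tuple X, exists x in C, subseq x a].

Definition turan_system (n k r : nat) (C : {set {set 'I_n}}) : bool :=
  [forall A in C, #|A| == r] &&
  [forall K : {set 'I_n}, (#|K| == k) ==> [exists A in C, A \subset K]].

(* The default values of the two minima below are themselves admissible when
   r <= k (covering_codeT, turan_system_full), so these are genuine minima. *)

Definition insertion_number (n k r : nat) : nat :=
  #|[arg min_(C < [set: r.-tuple 'I_n] | covering_code k C) #|C| ]|.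

Definition turan_number (n k r : nat) : nat :=
  #|[arg min_(C < [set A : {set 'I_n} | #|A| == r] | turan_system k r C) #|C| ]|.

Lemma covering_codeT (X : finType) (k r : nat) :
  r <= k -> covering_code k [set: r.-tuple X].
Proof.
move=> rk; apply/forallP => a; apply/existsP.
have sz : size (take r a) == r by rewrite size_takel // size_tuple.
by exists (Tuple sz); rewrite inE take_subseq.
Qed.

Lemma turan_system_full (n k r : nat) :
  r <= k -> turan_system k r [set A : {set 'I_n} | #|A| == r].
Proof.
move=> rk; apply/andP; split; first by apply/forallP => A; rewrite inE implybb.
apply/forallP => K; apply/implyP => /eqP Kk.
have : 0 < #|[set A : {set 'I_n} | A \subset K & #|A| == r]|.
  by rewrite cards_draws Kk bin_gt0.
case/card_gt0P => A; rewrite inE => /andP[AK Ar].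
by apply/existsP; exists A; rewrite inE Ar.
Qed.

Lemma insertion_numberP (n k r : nat) : r <= k ->
  (exists2 C : {set r.-tuple 'I_n}, covering_code k C
     & #|C| = insertion_number n k r) /\
  (forall C : {set r.-tuple 'I_n}, covering_code k C ->
     insertion_number n k r <= #|C|).
Proof.
move=> rk; rewrite /insertion_number.
case: arg_minnP => [|C hC minC]; first exact: covering_codeT.
by split=> //; exists C.
Qed.

Lemma turan_numberP (n k r : nat) : r <= k ->
  (exists2 C : {set {set 'I_n}}, turan_system k r C
     & #|C| = turan_number n k r) /\
  (forall C : {set {set 'I_n}}, turan_system k r C ->
     turan_number n k r <= #|C|).
Proof.
move=> rk; rewrite /turan_number.
case: arg_minnP => [|C hC minC]; first exact: turan_system_full.
by split=> //; exists C.
Qed.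

Local Open Scope ring_scope.
Local Open Scope classical_set_scope.

(* The finitely many n with a zero denominator (where x / 0 = 0) do not affect
   the limits. *)

Definition insertion_density (R : realType) (k r : nat) : R :=
  lim (((insertion_number n k r)%:R / n%:R ^+ r : R) @[n --> \oo]).

Definition turan_density (R : realType) (k r : nat) : R :=
  lim (((turan_number n k r)%:R / 'C(n, r)%:R : R) @[n --> \oo]).

(* Main.v *)
Require Import Defs.
From mathcomp Require Import all_boot all_order all_algebra.
From mathcomp Require Import all_classical all_reals all_analysis.
Import Order.TTheory GRing.Theory Num.Theory.
Import numFieldNormedType.Exports.
Local Open Scope ring_scope.

(** A Turan system C on n points turns into a covering code: take all the
    sequences whose entries are the r elements of some member of C, in any
    order, together with all the sequences of length r that have a repeated
    entry. A sequence a of length k with distinct entries is covered through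
    the member of C contained in its set of entries, and, for r > 1, a sequence
    with a repeated entry has a subsequence of length r that still contains
    the repetition. So
      S(n,k,r) <= r! T(n,k,r) + (n^r - n(n-1)...(n-r+1))
    ([insertion_number_le_turan]); dividing by n^r gives
      S(n,k,r)/n^r <= T(n,k,r)/binom(n,r) + o(1).
    For r = 1 there are no repetitions to keep, but both densities equal 1: only
    S <= n and T >= n - k ([leq_turan_number1]) are needed.

    Passing to the limit requires both sequences to converge, as [lim] is
    meaningless otherwise. The Turan ratio is nondecreasing, by averaging over
    the deletion of one vertex ([turan_number_averaging]), and at most 1. For
    the insertion ratio, the pullback of a code over [n] along reduction modulo
    n shows S(m) <= (m/n + 1)^r S(n) ([insertion_number_blowup]); hence
    S(m)/m^r <= (1 + n/m)^r S(n)/n^r, and the ratios converge to their infimum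
    ([cvg_inf_of_upper]). *)

(** * Bounds on Turan numbers and insertion numbers *)

(** Deleting a vertex v from a Turan system on n.+1 points leaves the members
    that avoid v, which form a Turan system on n points. *)
Lemma turan_number_averaging (n k r : nat) : (r <= k)%N ->
  (n.+1 * turan_number n k r <= (n.+1 - r) * turan_number n.+1 k r)%N.
Proof.
move=> rk; have [[C /andP[/'forall_implyP cardC hitC] <-] _] :=
  turan_numberP n.+1 rk.
have [_ minT] := turan_numberP n rk.
(* [D] transports the members that avoid v to n points, along [lift v]. *)
have link (v : 'I_n.+1) :
    (turan_number n k r <= \sum_(A in C) (v \notin A))%N.
  set D := [set A : {set 'I_n} | lift v @: A \in C].
  have liftI : injective (fun A : {set 'I_n} => lift v @: A).
    exact/imset_inj/lift_inj.
  have -> : (\sum_(A in C) (v \notin A))%N = #|[set A in C | v \notin A]|.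
    by rewrite -big_mkcondr /= sum1dep_card.
  apply: (@leq_trans #|D|).
    apply: minT; apply/andP; split.
      apply/forallP => A; apply/implyP; rewrite inE => /cardC.
      by rewrite card_imset //; exact: lift_inj.
    apply/forallP => K; apply/implyP => Kk.
    have /forallP/(_ (lift v @: K)) := hitC.
    rewrite card_imset ?Kk /=; last exact: lift_inj.
    case/existsP => A /andP[AC AK]; apply/existsP; exists (lift v @^-1: A).
    have preA : lift v @: (lift v @^-1: A) = A.
      apply/finset.setP => i; apply/imsetP/idP => [[j + ->]|iA]; first by rewrite inE.
      have /imsetP[j jK ij] := fintype.subsetP AK _ iA.
      by exists j; rewrite // inE -ij.
    rewrite inE preA AC /=; apply/fintype.subsetP => j; rewrite inE => /(fintype.subsetP AK).
    by case/imsetP => i iK /lift_inj ->.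
  rewrite -(card_imset _ liftI); apply: subset_leq_card.
  apply/fintype.subsetP => _ /imsetP[A + ->]; rewrite !inE => -> /=.
  by apply/imsetP => -[j _ /eqP]; rewrite (negbTE (neq_lift _ _)).
have -> : (n.+1 * turan_number n k r = \sum_(v < n.+1) turan_number n k r)%N.
  by rewrite sum_nat_const card_ord.
apply: (@leq_trans (\sum_(v < n.+1) \sum_(A in C) (v \notin A))).
  by apply: leq_sum => v _; exact: link.
(* Each member, having r elements, avoids n.+1 - r vertices. *)
rewrite exchange_big mulnC -sum_nat_const leq_sum // => A AC.
have -> : (\sum_(v < n.+1) (v \notin A) = #|~: A|)%N.
  rewrite -sum1_card [RHS]big_mkcond; apply: eq_bigr => v _.
  by rewrite inE; case: (v \in A).
by rewrite cardsCs finset.setCK card_ord (eqP (cardC _ AC)).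
Qed.

(** The pullback of a covering code along reduction modulo n is a covering code,
    and reduction modulo n has fibres of size at most m %/ n + 1. *)
Lemma insertion_number_blowup (m n k r : nat) : (0 < n)%N -> (r <= k)%N ->
  (insertion_number m k r <= (m %/ n).+1 ^ r * insertion_number n k r)%N.
Proof.
case: n => // n _ rk; have [[C /forallP covC <-] _] := insertion_numberP n.+1 rk.
have [_ minS] := insertion_numberP m rk.
pose g (i : 'I_m) : 'I_n.+1 := inord (i %% n.+1).
pose q (i : 'I_m) : 'I_(m %/ n.+1).+1 := inord (i %/ n.+1).
have gqI : injective (fun i => (g i, q i)).
  move=> i j [/(congr1 val) /= + /(congr1 val) /=].
  rewrite !inordK ?ltn_pmod ?ltnS ?leq_div2r ?(ltnW (ltn_ord _)) // => gij qij.
  by apply: val_inj; rewrite /= (divn_eq i n.+1) (divn_eq j n.+1) gij qij.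
set D := [set y : r.-tuple 'I_m | map_tuple g y \in C].
apply: (@leq_trans #|D|).
  apply: minS; apply/forallP => a.
  have /existsP[x /andP[xC /subseqP[b bs xE]]] := covC (map_tuple g a).
  have sz : size (mask b a) == r.
    by rewrite -(size_map g) map_mask -xE size_tuple.
  apply/existsP; exists (Tuple sz); rewrite inE mask_subseq andbT.
  suff -> : map_tuple g (Tuple sz) = x by [].
  by apply: val_inj; rewrite /= map_mask -xE.
(* A tuple is determined by its residues and its quotients. *)
pose h (y : r.-tuple 'I_m) := (map_tuple g y, map_tuple q y).
have hI : injective h.
  move=> y z yz; apply: eq_from_tnth => i; apply: gqI; congr pair.
    by rewrite -!(tnth_map g); congr tnth; exact: (congr1 fst yz).
  by rewrite -!(tnth_map q); congr tnth; exact: (congr1 snd yz).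
rewrite -(card_imset _ hI).
have -> : ((m %/ n.+1).+1 ^ r * #|C|)%N
    = #|finset.setX C [set: r.-tuple 'I_(m %/ n.+1).+1]|.
  by rewrite cardsX cardsT card_tuple card_ord mulnC.
apply: subset_leq_card; apply/fintype.subsetP => _ /imsetP[y + ->].
by rewrite !inE /= andbT.
Qed.

Lemma subseq_extend (T : eqType) (y s : seq T) (r : nat) :
  subseq y s -> (size y <= r <= size s)%N ->
  exists x, [/\ subseq y x, subseq x s & size x = r].
Proof.
elim: s y r => [|a s IHs] y r ys /andP[yr].
  by rewrite leqn0 => /eqP ->; exists [::].
rewrite leq_eqVlt => /predU1P[->|]; first by exists (a :: s).
rewrite ltnS => rs; have [ys'|] := boolP (subseq y s).
  have [|x [yx xs xr]] := IHs _ r ys'; first by rewrite yr.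
  by exists x; split=> //; apply: subseq_trans xs (subseq_cons _ _).
case: y ys yr => [|b y] /=; first by rewrite sub0seq.
case: eqP => [->|_ -> //] ys yr _; case: r yr rs => // r yr rs.
have [|x [yx xs xr]] := IHs _ r ys; first by rewrite -ltnS yr ltnW.
by exists (a :: x); rewrite /= eqxx xr.
Qed.

(** A repetition survives in some subsequence of each length from 2 to size s. *)
Lemma not_uniq_subseq (T : eqType) (s : seq T) (r : nat) :
  ~~ uniq s -> (1 < r <= size s)%N ->
  exists x, [/\ subseq x s, size x = r & ~~ uniq x].
Proof.
move=> us rs; have [c cs] : exists c, subseq [:: c; c] s.
  elim: s us {rs} => //= a s IHs; rewrite negb_and negbK => /orP[aS|/IHs[c cs]].
    by exists a; rewrite eqxx sub1seq.
  by exists c; case: eqP => // _; apply: subseq_trans cs; exact: suffix_subseq [:: c] _.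
have [x [cx xs xr]] := subseq_extend _ _ _ _ cs rs.
by exists x; split=> //; apply/negP => /(subseq_uniq cx); rewrite /= inE eqxx.
Qed.

(** The code consists of the orderings of the members of a Turan system and of
    the sequences with a repeated entry. The hypothesis 1 < r is needed for the
    latter to cover the sequences of length k with a repeated entry. *)
Lemma insertion_number_le_turan (n k r : nat) : (1 < r)%N -> (r <= k)%N ->
  (insertion_number n k r <= r`! * turan_number n k r + (n ^ r - n ^_ r))%N.
Proof.
move=> r1 rk; have [[C /andP[/'forall_implyP cardC hitC] <-] _] :=
  turan_numberP n rk.
have [_ minS] := insertion_numberP n rk.
pose U := [set x : r.-tuple 'I_n | uniq x].
pose D := [set x : r.-tuple 'I_n in U | [set i in x] \in C].
have cardU : #|U| = (n ^_ r)%N.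
  rewrite -[in RHS](card_ord n) -card_uniq_tuples; apply: eq_card => x.
  by rewrite !inE; case: uniq; rewrite ?andbF // andbT; apply/esym/allP.
have cardD : (#|D| <= r`! * #|C|)%N.
  rewrite -sum1_card.
  rewrite (partition_big (fun x : r.-tuple 'I_n => [set i in x]) (mem C)) /=;
    last first.
    by move=> x /setIdP[].
  rewrite mulnC -sum_nat_const leq_sum // => A AC.
  rewrite sum1dep_card -ffactnn -[X in (_ <= X ^_ _)%N](eqP (cardC _ AC)).
  rewrite -card_uniq_tuples; apply: subset_leq_card; apply/fintype.subsetP => x.
  rewrite !inE => /andP[/andP[-> _] /eqP <-]; rewrite andbT.
  by apply/allP => i ix; have : i \in [set j in x] by rewrite inE.
apply: (@leq_trans #|D :|: ~: U|); last first.
  apply: leq_trans (leq_card_setU _ _) _; rewrite leq_add //.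
  by rewrite cardsCs finset.setCK cardU card_tuple card_ord.
apply: minS; apply/forallP => a; have [ua|nua] := boolP (uniq a).
  have /forallP/(_ [set i in a]) := hitC.
  rewrite cardsE (card_uniqP ua) size_tuple eqxx /=.
  case/existsP => A /andP[AC /fintype.subsetP AK].
  pose x := [seq i <- a | i \in A].
  have ux : uniq x by rewrite filter_uniq.
  have xA : [set i in x] = A.
    apply/finset.setP => i; rewrite inE mem_filter; case iA: (i \in A) => //=.
    by have := AK _ iA; rewrite inE.
  have sz : size x == r by rewrite -(card_uniqP ux) -cardsE xA cardC.
  apply/existsP; exists (Tuple sz); rewrite filter_subseq andbT !inE /=.
  by rewrite ux xA AC.
have [|x [xa /eqP xr nux]] := not_uniq_subseq _ _ r nua.
  by rewrite size_tuple r1.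
by apply/existsP; exists (Tuple xr); rewrite !inE nux orbT.
Qed.

(** The points outside a Turan system of singletons are fewer than k. *)
Lemma leq_turan_number1 (n k : nat) : (0 < k)%N ->
  (n <= turan_number n k 1 + k)%N.
Proof.
move=> k0; have [[C /andP[/'forall_implyP cardC hitC] <-] _] :=
  turan_numberP n k0.
have coverC : (#|finset.cover C| <= #|C|)%N.
  apply: leq_trans (leq_card_cover C) _.
  by rewrite -sum1_card; apply: leq_sum => A /cardC /eqP ->.
have : (#|~: finset.cover C| < k)%N.
  rewrite ltnNge; apply/negP => /card_geqP[s [us /eqP sk sC]].
  have /forallP/(_ [set i in s]) := hitC.
  rewrite cardsE (card_uniqP us) sk => /existsP[A /andP[AC /fintype.subsetP As]].
  have /cards1P[i Ai] := cardC _ AC.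
  have iA : i \in A by rewrite Ai inE.
  have := As _ iA; rewrite inE => /sC; rewrite inE => /finset.bigcupP[]; by exists A.
have nE : n = (#|finset.cover C| + #|~: finset.cover C|)%N.
  by rewrite cardsC card_ord.
by move=> /ltnW ltk; rewrite [leqLHS]nE; exact: leq_add.
Qed.

Lemma insertion_number_le (n k r : nat) : (r <= k)%N ->
  (insertion_number n k r <= n ^ r)%N.
Proof.
move=> rk; have [_ minS] := insertion_numberP n rk.
apply: leq_trans (minS _ (covering_codeT _ rk)) _.
by rewrite cardsT card_tuple card_ord.
Qed.

Lemma turan_number_le (n k r : nat) : (r <= k)%N ->
  (turan_number n k r <= 'C(n, r))%N.
Proof.
move=> rk; have [_ minT] := turan_numberP n rk.
apply: leq_trans (minT _ (turan_system_full _ rk)) _.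
by rewrite card_draws card_ord.
Qed.

(** * Convergence of the densities *)

Local Open Scope classical_set_scope.

(** A nonnegative sequence u dominated, for each n > 0, by a sequence tending to
    u n converges to its infimum over the positive indices (as in Fekete's
    lemma). *)
Lemma cvg_inf_of_upper (R : realType) (u : nat -> R) (v : nat -> nat -> R) :
  (forall n, 0 <= u n) ->
  (forall n, (0 < n)%N -> v n m @[m --> \oo] --> u n) ->
  (forall m n, (0 < m)%N -> (0 < n)%N -> u m <= v n m) ->
  u n @[n --> \oo] --> inf [set u n | n in [set n | (0 < n)%N]].
Proof.
move=> u0 vu uv; set E := (X in inf X); have infE : has_inf E.
  by split; [exists (u 1%N), 1%N | exists 0 => _ [n _ <-]].
apply/cvgrPdist_lt => e e0; have [_ [n n0 <-] une] := inf_adherent e0 infE.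
near=> m; have m0 : (0 < m)%N by near: m; exact: nbhs_infty_gt.
have lm : inf E <= u m by apply: ge_inf; [exact: infE.2 | exists m].
rewrite distrC ger0_norm ?subr_ge0 // ltrBlDl.
apply: le_lt_trans (uv m n m0 n0) _.
by near: m; exact: (cvgr_lt _ (vu n n0)).
Unshelve. all: by end_near. Qed.

Lemma cvg_natdiv0 (R : realType) (c : R) : c / n%:R @[n --> \oo] --> 0.
Proof.
rewrite -[X in _ --> X](mulr0 c); apply: cvgMr.
apply/gtr0_cvgV0; last exact: cvgr_idn.
by near=> n; rewrite ltr0n; near: n; exact: nbhs_infty_gt.
Unshelve. all: by end_near. Qed.

Lemma cvg_exprn (R : realType) (u : nat -> R) (l : R) (r : nat) :
  u n @[n --> \oo] --> l -> u n ^+ r @[n --> \oo] --> l ^+ r.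
Proof. exact: (continuous_cvg _ (@exprn_continuous R r l)). Qed.

Lemma cvg_insertion_density (R : realType) (k r : nat) : (r <= k)%N ->
  cvg (((insertion_number n k r)%:R / n%:R ^+ r : R) @[n --> \oo]).
Proof.
move=> rk; pose v n m : R :=
  (insertion_number n k r)%:R / n%:R ^+ r * (1 + n%:R / m%:R) ^+ r.
apply: cvgP; apply: (cvg_inf_of_upper R _ v).
- by move=> n; rewrite divr_ge0 ?exprn_ge0 ?ler0n.
- move=> n _; rewrite -[X in _ --> X]mulr1 -[X in _ * X](expr1n _ r).
  apply: cvgMr; apply: cvg_exprn.
  rewrite -[X in _ --> X]addr0; apply: cvgD; [exact: cvg_cst|].
  exact: cvg_natdiv0.
- move=> m n m0 n0; have mR : 0 < m%:R :> R by rewrite ltr0n.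
  have nR : 0 < n%:R :> R by rewrite ltr0n.
  rewrite ler_pdivrMr ?exprn_gt0 // /v -!mulrA -exprVn -!exprMn.
  apply: (@le_trans _ _ ((m %/ n).+1 ^ r * insertion_number n k r)%:R).
    by rewrite ler_nat insertion_number_blowup.
  rewrite mulnC natrM natrX ler_wpM2l // lerXn2r ?nnegrE ?ler0n //.
  rewrite mulrC ler_pdivlMr // mulrDl mul1r divfK ?gt_eqF // -natrM -natrD ler_nat.
  by rewrite mulSn addnC leq_add2r leq_divM.
Qed.

(** For n < r the ratio is 0, its denominator being 0. *)
Lemma turan_density_nondecreasing (R : realType) (k r : nat) : (r <= k)%N ->
  nondecreasing_seq (fun n => (turan_number n k r)%:R / 'C(n, r)%:R : R).
Proof.
move=> rk; apply/nondecreasing_seqP => n.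
have [nr|rn] := ltnP n r.
  by rewrite (bin_small nr) invr0 mulr0 divr_ge0 ?ler0n.
rewrite ler_pdivrMr ?ltr0n ?bin_gt0 // mulrAC.
rewrite ler_pdivlMr ?ltr0n ?bin_gt0 ?leqW // -!natrM ler_nat.
have d0 : (0 < n.+1 - r)%N by rewrite subn_gt0.
(* The binomials cancel by (n + 1 - r) 'C(n + 1, r) = (n + 1) 'C(n, r). *)
rewrite -(leq_pmul2l d0) mulnCA -mul_bin_down mulnA [leqRHS]mulnA.
by rewrite [X in (X * _ <= _)%N]mulnC leq_mul2r turan_number_averaging ?orbT.
Qed.

Lemma cvg_turan_density (R : realType) (k r : nat) : (r <= k)%N ->
  cvg (((turan_number n k r)%:R / 'C(n, r)%:R : R) @[n --> \oo]).
Proof.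
move=> rk; apply: nondecreasing_is_cvgn; first exact: turan_density_nondecreasing.
exists 1 => _ [n _ <-]; have [nr|rn] := ltnP n r.
  by rewrite (bin_small nr) invr0 mulr0.
by rewrite ler_pdivrMr ?ltr0n ?bin_gt0 // mul1r ler_nat turan_number_le.
Qed.

(** * Comparison of the densities *)

Lemma leq_subX_ffact (n m : nat) : ((n - m) ^ m <= n ^_ m)%N.
Proof.
elim: m n => [|m IHm] [|n] //; first by rewrite sub0n exp0n.
rewrite subSS expnS ffactnS leq_mul ?IHm //.
by rewrite (leq_trans (leq_subr _ _)).
Qed.

(** The error term bounds the proportion of sequences with a repeated entry. *)
Lemma insertion_ratio_le_turan (R : realType) (n k r : nat) :
  (1 < r)%N -> (r <= k)%N -> (r <= n)%N ->
  (insertion_number n k r)%:R / n%:R ^+ r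
    <= (turan_number n k r)%:R / 'C(n, r)%:R + (1 - (1 - r%:R / n%:R) ^+ r) :> R.
Proof.
move=> r1 rk rn; set t := _ / 'C(n, r)%:R.
have n0 : 0 < n%:R :> R by rewrite ltr0n (leq_trans (ltnW r1)).
have b0 : 0 < 'C(n, r)%:R :> R by rewrite ltr0n bin_gt0.
have nr0 : 0 < n%:R ^+ r :> R by rewrite exprn_gt0.
have t0 : 0 <= t by rewrite divr_ge0 ?ler0n.
have fn : (n ^_ r <= n ^ r)%N.
  rewrite -[X in (_ <= X ^ _)%N]card_ord -card_tuple -[X in (X ^_ _)%N]card_ord.
  by rewrite -card_uniq_tuples max_card.
have tE : (r`! * turan_number n k r)%:R = t * (n ^_ r)%:R :> R.
  by rewrite -bin_ffact !natrM /t mulrA divfK ?gt_eqF // mulrC.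
have le1 := insertion_number_le_turan n k r r1 rk.
rewrite -(ler_nat R) natrD tE natrB // natrX in le1.
have le2 : ((n%:R - r%:R) ^+ r : R) <= (n ^_ r)%:R.
  by rewrite -natrB // -natrX ler_nat leq_subX_ffact.
have le3 : (n ^_ r)%:R <= n%:R ^+ r :> R by rewrite -natrX ler_nat.
rewrite ler_pdivrMr // mulrDl mulrBl mul1r -exprMn mulrBl mul1r divfK ?gt_eqF //.
apply: le_trans le1 _; rewrite lerD ?ler_wpM2l // lerB //.
Qed.

Theorem corollary12 (R : realType) (k r : nat) (r_gt0 : (0 < r)%N)
    (r_lt_k : (r < k)%N) :
  insertion_density R k r <= turan_density R k r.
Proof.
have rk := ltnW r_lt_k.
have [e e0 le_e] : exists2 e : nat -> R, e n @[n --> \oo] --> 0 &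
    forall n, (r <= n)%N -> (insertion_number n k r)%:R / n%:R ^+ r
      <= (turan_number n k r)%:R / 'C(n, r)%:R + e n.
  move: r_gt0; rewrite leq_eqVlt => /predU1P[r1|r1]; last first.
    exists (fun n => 1 - (1 - r%:R / n%:R) ^+ r); last first.
      by move=> n; exact: insertion_ratio_le_turan.
    rewrite -[X in _ --> X](subrr 1) -[X in _ --> _ - X](expr1n _ r).
    apply: cvgB; first exact: cvg_cst.
    apply: cvg_exprn.
    rewrite -[X in _ --> X]subr0; apply: cvgB; [exact: cvg_cst|].
    exact: cvg_natdiv0.
  (* For r = 1, S <= n <= T + k. *)
  exists (fun n => k%:R / n%:R); first exact: cvg_natdiv0.
  rewrite -{}r1 in rk *; move=> n n0; rewrite bin1 expr1 -mulrDl.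
  rewrite ler_pM2r ?invr_gt0 ?ltr0n // -natrD ler_nat.
  by rewrite (leq_trans _ (leq_turan_number1 _ _ rk)) // insertion_number_le.
have te : (turan_number n k r)%:R / 'C(n, r)%:R + e n @[n --> \oo]
    --> turan_density R k r.
  by rewrite -[X in _ --> X]addr0; apply: cvgD e0; exact: cvg_turan_density.
rewrite -(cvg_lim _ te) //.
apply: ler_lim; [exact: cvg_insertion_density | exact: cvgP te |].
by near=> n; apply: le_e; near: n; exact: nbhs_infty_ge.
Unshelve. all: by end_near. Qed.
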